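(* Let $0<\Gamma<1$ and $0<\epsilon<M\,\mathrm{dist}(x_0,X_\Omega)$, let $L\ge 1$ be an integer, and set $$p = 1-(1-\Gamma)^L,\qquad \mathbb{E} = \frac1p\left(\frac{M\,\mathrm{dist}(x_0,X_\Omega)}{\epsilon}\right)^2 .$$ Run the algorithm PolyakFM with inputs $x_0$ and $L$, and let $x_0,x_1,x_2,\dots$ be its (random) iterates. Then PolyakFM reaches an iterate $x_k$ satisfying $P(\Omega(x_k,\epsilon))\ge 1-\Gamma$ within an expected number of iterations not exceeding $\mathbb{E}$; that is, the expected value of the random variable $\min\{k\ge 0 : P(\Omega(x_k,\epsilon))\ge 1-\Gamma\}$ is at most $\mathbb{E}$. Moreover, for every integer $k\ge 2\mathbb{E}$, $$\mathrm{Prob}\big(x_k \text{ is the first iterate satisfying } P(\Omega(x_k,\epsilon))\ge 1-\Gamma\big)\ \le\ \frac12\left(\frac{1}{1+\frac12\frac{p}{1-p}}\right)^{k-\lceil 2\mathbb{E}\rceil}.$$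
   Context: Setting. $(\Omega,\mathcal F,P)$ is a probability space ($\Omega$ may be finite or infinite). For each $\omega\in\Omega$, $f_\omega:\mathbb{R}^n\to\mathbb{R}$ is a convex function. $\|\cdot\|$ is the Euclidean norm. All sets and maps whose probabilities or expectations are taken are understood to be measurable. Define $X_\Omega=\{x : f_\omega(x)\le 0 \text{ for all } \omega\in\Omega\}$, assumed nonempty, and let $\mathrm{dist}(x,X_\Omega)$ denote the Euclidean distance from $x$ to $X_\Omega$. For a point $x$ and a scalar $\epsilon>0$ let $\Omega(x,\epsilon)=\{\omega\in\Omega : f_\omega(x)\le\epsilon\}$. Fix an initial point $x_0$; let $z_0$ be the point of $X_\Omega$ closest to $x_0$, and let $\mathcal B=\{x:\|x-z_0\|\le\|x_0-z_0\|\}$. It is assumed that, for every $\omega$, $f_\omega$ is $M$-Lipschitz (i.e. $|f_\omega(x)-f_\omega(y)|\le M\|x-y\|$) on an open neighborhood of $\mathcal B$. For each $\omega$ and $x$, $g_\omega(x)$ denotes a fixed element of the subdifferential $\partial f_\omega(x)$ (a fixed subgradient selection). Algorithm PolyakFM (input: $x_0$ and an integer $L\ge1$, the minibatch size). For $k=1,2,3,\dots$: (1) Independently draw samples $\omega_{k,1},\dots,\omega_{k,L}$ from $(\Omega,\mathcal F,P)$ (with replacement, and independently of all earlier samples). (2) Let $\ell_k$ be an index maximizing $f_{\omega_{k,\ell}}(x_{k-1})$ over $\ell=1,\dots,L$ (ties broken by a fixed rule) and let $\epsilon_{k-1}=f_{\omega_{k,\ell_k}}(x_{k-1})$. If $\epsilon_{k-1}\le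 0$, set $x_k=x_{k-1}$; otherwise set $x_k=x_{k-1}-\frac{\epsilon_{k-1}}{\|g\|^2}\,g$ where $g=g_{\omega_{k,\ell_k}}(x_{k-1})$. $\mathrm{Prob}$ and expected values refer to the random draws of all the samples. *)

(* Defs.v *)
From HB Require Import structures.
From mathcomp Require Import all_boot all_order all_algebra finmap.
From mathcomp Require Import all_classical all_reals all_analysis.
Set Implicit Arguments.
Unset Strict Implicit.
Unset Printing Implicit Defensive.
Import Order.TTheory GRing.Theory Num.Theory.
Import numFieldNormedType.Exports.
Local Open Scope classical_set_scope.
Local Open Scope ring_scope.

(* The library norm `|x| on 'rV[R]_n is the sup norm, so the Euclidean norm
   is defined here. *)
Definition eucl_dot (R : realType) (n : nat) (u v : 'rV[R]_n) : R :=
  \sum_(i < n) u 0 i * v 0 i.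

Definition eucl_norm (R : realType) (n : nat) (u : 'rV[R]_n) : R :=
  Num.sqrt (eucl_dot u u).

Definition eucl_dist (R : realType) (n : nat) (x : 'rV[R]_n)
    (A : set 'rV[R]_n) : R :=
  inf [set eucl_norm (x - z) | z in A].

Definition eucl_ball (R : realType) (n : nat) (c : 'rV[R]_n) (r : R) :
    set 'rV[R]_n :=
  [set x | eucl_norm (x - c) <= r].

Definition closest_point (R : realType) (n : nat) (A : set 'rV[R]_n)
    (x z : 'rV[R]_n) : Prop :=
  A z /\ forall y, A y -> eucl_norm (x - z) <= eucl_norm (x - y).

Definition eucl_lipschitz_on (R : realType) (n : nat) (M : R)
    (U : set 'rV[R]_n) (h : 'rV[R]_n -> R) : Prop :=
  forall x y, U x -> U y -> `|h x - h y| <= M * eucl_norm (x - y).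

Definition subdifferential (R : realType) (n : nat) (h : 'rV[R]_n -> R)
    (x : 'rV[R]_n) : set 'rV[R]_n :=
  [set v | forall y, h x + eucl_dot v (y - x) <= h y].

(* R^n with the sigma-algebra generated by the coordinate maps, as the library
   does for n.-tuple R; it is the Borel sigma-algebra. *)
Notation measurable_rV R n :=
  (g_sigma_algebraType
     (g_sigma_preimage (fun (i : 'I_n) (x : 'rV[R]_n) => x 0 i))).

Definition mutually_independent (R : realType) (d d' : measure_display)
    (S : measurableType d) (T : measurableType d') (Q : probability S R)
    (I : choiceType) (X : I -> S -> T) : Prop :=
  forall (J : {fset I}) (A : I -> set T), (forall i, measurable (A i)) ->
    Q (\bigcap_(i in [set` J]) X i @^-1` A i) =
    (\prod_(i <- J) fine (Q (X i @^-1` A i)))%:E.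

Section Polyak.
Variables (R : realType) (n : nat) (T : Type) (f : T -> 'rV[R]_n -> R).

Definition feasible : set 'rV[R]_n := [set x | forall w, f w x <= 0].

Definition Omega_eps (x : 'rV[R]_n) (eps : R) : set T :=
  [set w | f w x <= eps].

Variables (g : T -> 'rV[R]_n -> 'rV[R]_n) (L : nat).

(* A rule picking, at the current point and for the current minibatch, the
   index of a most violated constraint.  The way it breaks ties is arbitrary. *)
Definition argmax_rule (sel : 'rV[R]_n -> L.-tuple T -> 'I_L) : Prop :=
  forall x w l, f (tnth w l) x <= f (tnth w (sel x w)) x.

Variable sel : 'rV[R]_n -> L.-tuple T -> 'I_L.

Definition polyak_step (x : 'rV[R]_n) (w : L.-tuple T) : 'rV[R]_n :=
  let o := tnth w (sel x w) in
  if f o x <= 0 then x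
  else x - (f o x / eucl_norm (g o x) ^+ 2) *: g o x.

(* [w k] is the minibatch of iteration k + 1, the one producing x_(k+1). *)
Fixpoint polyakFM (x0 : 'rV[R]_n) (w : nat -> L.-tuple T) (k : nat) :
    'rV[R]_n :=
  if k is j.+1 then polyak_step (polyakFM x0 w j) (w j) else x0.

End Polyak.

(* min {k | good k}, equal to +oo when no k is good. *)
Definition first_time (R : realType) (good : set nat) : \bar R :=
  ereal_inf [set (k%:R)%:E | k in good].

Definition is_first (good : set nat) (k : nat) : Prop :=
  good k /\ forall j, (j < k)%N -> ~ good j.

(* Main.v *)
Require Import Defs.
From HB Require Import structures.
From mathcomp Require Import all_boot all_order all_algebra finmap.
From mathcomp Require Import all_classical all_reals all_analysis.
From mathcomp Require Import measurable_realfun ring lra.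
Set Implicit Arguments.
Unset Strict Implicit.
Unset Printing Implicit Defensive.
Import Order.TTheory GRing.Theory Num.Theory.
Import numFieldNormedType.Exports.
Local Open Scope classical_set_scope.
Local Open Scope ring_scope.

(** Why the theorem holds. A Polyak step projects onto a half-space that
    contains every feasible point, in particular [z0], so the squared distance
    of the iterates to [z0] never increases; it drops by at least
    [(eps / M) ^ 2] whenever the minibatch contains a constraint violated by
    more than [eps] (subgradients have norm at most [M] on the ball around [z0] that the
    iterates never leave). Call such an iteration a success. While the current
    iterate is not good, some constraint is violated by more than [eps], so by
    the Lipschitz bound the squared distance still exceeds [(eps / M) ^ 2].
    Hence, with [N = (M dist / eps) ^ 2], an iterate that is not good is
    preceded by fewer than [m] successes, where [m] is the largest integer
    below [N] ([violations_lt]).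

    An iteration that starts from an iterate that is not good succeeds with
    conditional probability at least [p = 1 - (1 - Gamma) ^ L], since each of
    the [L] fresh samples respects the iterate up to [eps] with probability
    below [1 - Gamma]. Conditioning on the past is done on the sigma-algebra
    generated by the earlier samples: mutual independence makes the joint law
    of that past and a new sample a product measure ([history_independent],
    [section_bound]). This needs the constraints to be jointly measurable in
    the point and the sample, which follows from the Lipschitz bound through a
    countable dense subset of the ball ([measurable_sublevel]).

    Consequently the probability that the iterates [x_0, ..., x_k] are all not
    good is at most the probability [binom_tail p k m] of fewer than [m]
    successes in [k] independent trials ([waiting_tail]). Both claims are now
    facts about the binomial distribution. The expected hitting time is the
    sum over [k] of the probabilities of still waiting at [k], at most
    [m / p < N / p]. The hitting time equals [k] only if the process is still waiting
    at [k - 1]; Markov's inequality bounds [binom_tail p (k - 1) m] by 1/2 at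
    [k = ceil (2 E)], and from there on each further trial multiplies the tail
    by at most [(1 - p) / (1 - p / 2)], because [m] stays below half of the
    mean [k p] ([binom_tail_geometric]). *)

(** * The lower tail of the binomial distribution *)

(** The probability of fewer than [j] successes in [k] independent trials of
    success probability [p]. *)
Definition binom_tail (R : realType) (p : R) (k j : nat) : R :=
  \sum_(i < j) 'C(k, i)%:R * p ^+ i * (1 - p) ^+ (k - i).

Lemma binom_tail_zero (R : realType) (p : R) j : binom_tail p 0 j.+1 = 1.
Proof.
rewrite /binom_tail big_ord_recl bin0 !expr0 !mulr1 big1 ?addr0// => i _.
by rewrite bin0n /= !mul0r.
Qed.

(** Condition on the outcome of the first trial. *)
Lemma binom_tail_rec (R : realType) (p : R) k j :
  binom_tail p k.+1 j.+1 =
  p * binom_tail p k j + (1 - p) * binom_tail p k j.+1.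
Proof.
rewrite /binom_tail big_ord_recl [X in _ + _ * X]big_ord_recl !bin0 !expr0.
rewrite !subn0 exprS !mulr1 !mul1r mulrDr addrCA; congr (_ + _).
rewrite !mulr_sumr -big_split/=; apply: eq_bigr => i _.
rewrite /bump/= !add1n binS natrD subSS exprS.
have [ik|ik] := leqP i.+1 k; last by rewrite (bin_small ik) add0r; ring.
by rewrite -[(k - i)%N]prednK ?subn_gt0// -subnS exprS; ring.
Qed.

Lemma binom_tail_ge0 (R : realType) (p : R) k j
    (p_gt0 : 0 < p) (p_lt1 : p < 1) :
  0 <= binom_tail p k j.
Proof.
have q_ge0 : 0 <= 1 - p by rewrite subr_ge0 ltW.
apply: sumr_ge0 => i _; apply: mulr_ge0; last exact: exprn_ge0.
by apply: mulr_ge0 => //; exact/exprn_ge0/ltW.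
Qed.

Lemma binom_tail_anti (R : realType) (p : R) k j
    (p_gt0 : 0 < p) (p_lt1 : p < 1) :
  binom_tail p k.+1 j <= binom_tail p k j.
Proof.
have q_ge0 : 0 <= 1 - p by rewrite subr_ge0 ltW.
case: j => [|j]; first by rewrite /binom_tail !big_ord0.
rewrite binom_tail_rec.
have : binom_tail p k j <= binom_tail p k j.+1.
  rewrite [leRHS]/binom_tail big_ord_recr/= lerDl; apply: mulr_ge0.
    by apply: mulr_ge0 => //; exact/exprn_ge0/ltW.
  exact: exprn_ge0.
set a := binom_tail p k j; set b := binom_tail p k j.+1 => ab.
by rewrite mulrBl mul1r addrCA gerDl subr_le0 ler_wpM2l// ltW.
Qed.

Lemma binom_tail_antiW (R : realType) (p : R) k l j
    (p_gt0 : 0 < p) (p_lt1 : p < 1) :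
  (k <= l)%N -> binom_tail p l j <= binom_tail p k j.
Proof.
move=> /subnKC <-; elim: (l - k)%N => [|i IH]; first by rewrite addn0.
by rewrite addnS (le_trans _ IH)// binom_tail_anti.
Qed.

(** Summed over all [k], the tails give the mean number of trials up to and
    including the [j]-th success, which is [j / p]. *)
Lemma sum_binom_tail (R : realType) (p : R) n j
    (p_gt0 : 0 < p) (p_lt1 : p < 1) :
  \sum_(k < n) binom_tail p k j <= j%:R / p.
Proof.
have q_ge0 : 0 <= 1 - p by rewrite subr_ge0 ltW.
elim: n j => [|n IH] [|j]; rewrite ?big_ord0 ?mul0r//.
- by rewrite divr_ge0// ltW.
- by rewrite big1// => k _; rewrite /binom_tail big_ord0.
rewrite big_ord_recl binom_tail_zero.
under eq_bigr do rewrite lift0 binom_tail_rec.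
rewrite big_split/= -!mulr_sumr.
have := IH j; have := IH j.+1; rewrite !ler_pdivlMr// -natr1.
set a := \sum_(_ < n) _; set b := \sum_(_ < n) _ => ha hb.
have := ler_wpM2l (ltW p_gt0) hb; have := ler_wpM2l q_ge0 ha.
by lra.
Qed.

(** Markov's inequality for the number of trials up to the [j]-th success. *)
Lemma binom_tail_markov (R : realType) (p : R) k j
    (p_gt0 : 0 < p) (p_lt1 : p < 1) :
  k.+1%:R * binom_tail p k j <= j%:R / p.
Proof.
apply: le_trans (sum_binom_tail k.+1 j p_gt0 p_lt1).
rewrite mulr_natl -[X in _ *+ X]card_ord -sumr_const.
by apply: ler_sum => i _; apply: binom_tail_antiW => //; rewrite -ltnS.
Qed.

(** Far below the mean, one more trial shrinks every term of the tail by the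
    factor [(k + 1) / (k + 1 - i) * (1 - p)], at most [(1 - p) / (1 - p / 2)]
    as long as [i] stays below half of the mean [(k + 1) p]. *)
Lemma binom_term_ratio (R : realType) (p : R) k i
    (p_gt0 : 0 < p) (p_lt1 : p < 1) :
  i%:R <= k.+1%:R * p / 2 ->
  'C(k.+1, i)%:R * p ^+ i * (1 - p) ^+ (k.+1 - i) <=
  (1 - p) / (1 - p / 2) * ('C(k, i)%:R * p ^+ i * (1 - p) ^+ (k - i)).
Proof.
have q_ge0 : 0 <= 1 - p by rewrite subr_ge0 ltW.
move=> ij.
have k1 : (0 : R) < k.+1%:R by [].
have ik : (i <= k)%N.
  rewrite -ltnS -(ltr_nat R); move: (k.+1%:R : R) ij k1 => x ij k1.
  have pk : x * p < x by rewrite gtr_pMr.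
  have xp : 0 < x * p by rewrite mulr_gt0.
  by lra.
have p2 : 0 < 1 - p / 2 by lra.
rewrite subSn// exprS.
have : ('C(k.+1, i))%:R * (k.+1%:R - i%:R) = k.+1%:R * 'C(k, i)%:R :> R.
  rewrite -natrB 1?leqW// -!natrM; congr _%:R.
  by rewrite mulnC -mul_bin_down.
set a := ('C(k.+1, i))%:R; set b := ('C(k, i))%:R => ab.
have a0 : 0 <= a by [].
have aleb : a * (1 - p / 2) <= b.
  rewrite -(ler_pM2l k1); apply: le_trans (_ : a * (k.+1%:R - i%:R) <= _).
    rewrite mulrCA ler_wpM2l//; by move: (k.+1%:R : R) ij => x ij; lra.
  by rewrite ab.
have z0 : 0 <= p ^+ i * (1 - p) ^+ (k - i) * ((1 - p) / (1 - p / 2)).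
  have p0 : 0 <= p := ltW p_gt0.
  by rewrite !mulr_ge0 ?exprn_ge0 ?invr_ge0// ltW.
have -> : a * p ^+ i * ((1 - p) * (1 - p) ^+ (k - i)) =
  (p ^+ i * (1 - p) ^+ (k - i) * ((1 - p) / (1 - p / 2))) * (a * (1 - p / 2)).
  by field; rewrite gt_eqF//; lra.
apply: (le_trans (ler_wpM2l z0 aleb)).
by rewrite le_eqVlt; apply/orP; left; apply/eqP; ring.
Qed.

Lemma binom_tail_ratio (R : realType) (p : R) k j
    (p_gt0 : 0 < p) (p_lt1 : p < 1) :
  j%:R <= k.+1%:R * p / 2 ->
  binom_tail p k.+1 j <= (1 - p) / (1 - p / 2) * binom_tail p k j.
Proof.
move=> jk; rewrite /binom_tail mulr_sumr; apply: ler_sum => i _.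
by apply: binom_term_ratio => //; apply: le_trans jk; rewrite ler_nat ltnW.
Qed.

Lemma binom_tail_geometric (R : realType) (p : R) k l j
    (p_gt0 : 0 < p) (p_lt1 : p < 1) :
  (k <= l)%N -> j%:R <= k.+1%:R * p / 2 ->
  binom_tail p l j <= 1 / 2 * ((1 - p) / (1 - p / 2)) ^+ (l - k).
Proof.
move=> /subnKC <-; rewrite addKn => jk.
have rho_ge0 : 0 <= (1 - p) / (1 - p / 2) by rewrite divr_ge0//; lra.
elim: (l - k)%N => [|i IH].
  rewrite addn0 expr0 mulr1.
  have := binom_tail_markov k j p_gt0 p_lt1; rewrite ler_pdivlMr// => h.
  have k1 : (0 : R) < k.+1%:R * p by rewrite mulr_gt0.
  rewrite -(ler_pM2l k1).
  by move: (k.+1%:R : R) h jk {k1} => x h jk; lra.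
rewrite addnS exprS mulrCA; apply: le_trans (ler_wpM2l rho_ge0 IH).
apply: binom_tail_ratio => //; apply: (le_trans jk).
by rewrite -!mulrA ler_wpM2r ?ler_nat ?ltnS ?leq_addr// divr_ge0// ltW.
Qed.

(** * Euclidean geometry of a Polyak step *)

Lemma eucl_dot_ge0 (R : realType) n (u : 'rV[R]_n) : 0 <= eucl_dot u u.
Proof. by apply: sumr_ge0 => i _; rewrite -expr2 sqr_ge0. Qed.

Lemma eucl_norm_ge0 (R : realType) n (u : 'rV[R]_n) : 0 <= eucl_norm u.
Proof. exact: sqrtr_ge0. Qed.

Lemma sqr_eucl_norm (R : realType) n (u : 'rV[R]_n) :
  eucl_norm u ^+ 2 = eucl_dot u u.
Proof. by rewrite sqr_sqrtr// eucl_dot_ge0. Qed.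

Lemma eucl_dotC (R : realType) n (u v : 'rV[R]_n) : eucl_dot u v = eucl_dot v u.
Proof. by apply: eq_bigr => i _; rewrite mulrC. Qed.

Lemma eucl_dotZr (R : realType) n t (u v : 'rV[R]_n) :
  eucl_dot u (t *: v) = t * eucl_dot u v.
Proof. by rewrite mulr_sumr; apply: eq_bigr => i _; rewrite mxE; ring. Qed.

Lemma eucl_normZ (R : realType) n t (u : 'rV[R]_n) :
  eucl_norm (t *: u) = `|t| * eucl_norm u.
Proof.
by rewrite /eucl_norm eucl_dotZr eucl_dotC eucl_dotZr mulrA -expr2
  sqrtrM ?sqr_ge0// sqrtr_sqr.
Qed.

Lemma eucl_normN (R : realType) n (u : 'rV[R]_n) : eucl_norm (- u) = eucl_norm u.
Proof. by rewrite -scaleN1r eucl_normZ normrN1 mul1r. Qed.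

Lemma sqr_eucl_normBZ (R : realType) n t (u v : 'rV[R]_n) :
  eucl_norm (u - t *: v) ^+ 2 =
  eucl_norm u ^+ 2 - 2 * t * eucl_dot v u + t ^+ 2 * eucl_norm v ^+ 2.
Proof.
rewrite !sqr_eucl_norm /eucl_dot !mulr_sumr -sumrB -big_split/=.
by apply: eq_bigr => i _; rewrite !mxE; ring.
Qed.

Lemma eucl_dist_closest (R : realType) n (A : set 'rV[R]_n) (x z : 'rV[R]_n) :
  closest_point A x z -> eucl_dist x A = eucl_norm (x - z).
Proof.
move=> [Az zmin]; rewrite /eucl_dist; apply/eqP; rewrite eq_le; apply/andP.
split.
  apply: ge_inf; last by exists z.
  by exists (eucl_norm (x - z)) => _ [y Ay <-]; exact: zmin.
apply: lb_le_inf; first by exists (eucl_norm (x - z)), z.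
by move=> _ [y Ay <-]; exact: zmin.
Qed.

(** Along the direction of the subgradient the function grows at least at the
    rate given by the norm of the subgradient. *)
Lemma subgradient_norm_le (R : realType) n (M : R) (U : set 'rV[R]_n)
    (h : 'rV[R]_n -> R) (x v : 'rV[R]_n) :
  0 <= M -> open U -> U x -> eucl_lipschitz_on M U h -> subdifferential h x v ->
  eucl_norm v <= M.
Proof.
move=> M0 oU Ux hU hv.
have [v0|v_neq0] := eqVneq (eucl_norm v) 0; first by rewrite v0.
have v_gt0 : 0 < eucl_norm v by rewrite lt_def v_neq0 eucl_norm_ge0.
have cvgx : (fun t : R => x + t *: v) @ 0 --> x.
  have : (fun t : R => x + t *: v) @ 0 --> x + 0 *: v.
    by apply: cvgD; [exact: cvg_cst|exact: scalel_continuous].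
  by rewrite scale0r addr0.
have /nbhs_ballP[e /= e0 eU] : \forall t \near (0 : R), U (x + t *: v).
  by apply: cvgx; exact: open_nbhs_nbhs.
have e2 : 0 < e / 2 by rewrite divr_gt0.
have Uy : U (x + (e / 2) *: v).
  apply: eU; rewrite /ball/= sub0r normrN gtr0_norm// ltr_pdivrMr// ltr_pMr//.
  by rewrite ltr1n.
have := hv (x + (e / 2) *: v).
rewrite addrAC subrr add0r eucl_dotZr -sqr_eucl_norm => grow.
have := hU _ _ Uy Ux; rewrite addrAC subrr add0r eucl_normZ (gtr0_norm e2) => lip.
have : e / 2 * eucl_norm v ^+ 2 <= M * (e / 2 * eucl_norm v).
  by apply: le_trans lip; apply: le_trans (ler_norm _); rewrite lerBrDl.
by rewrite [M * _]mulrCA (ler_pM2l e2) expr2 ler_pM2r.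
Qed.

(** A Polyak step projects onto the half-space where the linear minorant of the
    violated constraint is nonpositive.  That half-space contains every
    feasible point, so the step comes closer to each of them, by at least the
    length of the step in the Pythagorean sense. *)
Lemma polyak_projection (R : realType) n (h : 'rV[R]_n -> R) (x z v : 'rV[R]_n) :
  subdifferential h x v -> h z <= 0 -> 0 < h x ->
  0 < eucl_norm v /\
  eucl_norm (x - (h x / eucl_norm v ^+ 2) *: v - z) ^+ 2 <=
  eucl_norm (x - z) ^+ 2 - (h x / eucl_norm v) ^+ 2.
Proof.
move=> hv hz hx.
have : h x <= eucl_dot v (x - z).
  have := hv z; rewrite -opprB -scaleN1r eucl_dotZr => hvz; lra.
have [v0|v_neq0] := eqVneq (eucl_norm v) 0.
  have vi i : v 0 i = 0.
    have := sqr_eucl_norm v; rewrite v0 expr0n/= => /esym/eqP.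
    rewrite psumr_eq0; last by move=> j _; rewrite -expr2 sqr_ge0.
    by move=> /allP/(_ i (mem_index_enum _)); rewrite mulf_eq0 orbb => /eqP.
  rewrite /eucl_dot big1 => [|i _]; first by lra.
  by rewrite vi mul0r.
have v_gt0 : 0 < eucl_norm v by rewrite lt_def v_neq0 eucl_norm_ge0.
set dvx := eucl_dot v (x - z) => hdvx; split=> //.
rewrite addrAC sqr_eucl_normBZ -/dvx.
have s0 : 0 <= h x / eucl_norm v ^+ 2 by rewrite divr_ge0 ?exprn_ge0// ltW.
have -> : (h x / eucl_norm v) ^+ 2 = h x / eucl_norm v ^+ 2 * h x by field.
have -> : (h x / eucl_norm v ^+ 2) ^+ 2 * eucl_norm v ^+ 2 =
  h x / eucl_norm v ^+ 2 * h x by field.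
move: (h x / _) s0 => s s0; have := ler_wpM2l s0 hdvx; lra.
Qed.

(** * Potential argument along one run *)

Section polyak_run.
Variables (R : realType) (n : nat) (T : Type) (f : T -> 'rV[R]_n -> R).
Variables (g : T -> 'rV[R]_n -> 'rV[R]_n) (L : nat).
Variables (sel : 'rV[R]_n -> L.-tuple T -> 'I_L) (M eps : R) (x0 z0 : 'rV[R]_n).
Hypotheses (M_gt0 : 0 < M) (eps_gt0 : 0 < eps) (z0_feasible : feasible f z0).
Hypothesis f_lipschitz : forall w, exists U : set 'rV[R]_n,
  [/\ open U, eucl_ball z0 (eucl_norm (x0 - z0)) `<=` U
    & eucl_lipschitz_on M U (f w)].
Hypothesis g_subgradient : forall w x, subdifferential (f w) x (g w x).
Hypothesis sel_argmax : argmax_rule f sel.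

Local Notation B := (eucl_ball z0 (eucl_norm (x0 - z0))).

Lemma polyak_step_closer x w :
  eucl_norm (polyak_step f g sel x w - z0) ^+ 2 <= eucl_norm (x - z0) ^+ 2.
Proof.
rewrite /polyak_step; set o := tnth w _; case: (leP (f o x) 0) => // fx.
have [_] := polyak_projection (g_subgradient o x) (z0_feasible o) fx.
by move=> /le_trans; apply; rewrite gerBl sqr_ge0.
Qed.

Lemma polyak_step_progress x w l : B x -> eps < f (tnth w l) x ->
  eucl_norm (polyak_step f g sel x w - z0) ^+ 2 <=
  eucl_norm (x - z0) ^+ 2 - (eps / M) ^+ 2.
Proof.
move=> Bx /lt_le_trans/(_ (sel_argmax x w l)).
rewrite /polyak_step; set o := tnth w _ => epsf.
have fx : 0 < f o x := lt_trans eps_gt0 epsf.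
rewrite (lt_geF fx).
have [v0] := polyak_projection (g_subgradient o x) (z0_feasible o) fx.
move=> /le_trans; apply; rewrite lerD2l lerN2.
have [U [oU BU fU]] := f_lipschitz o.
have gM : eucl_norm (g o x) <= M.
  exact: subgradient_norm_le (ltW M_gt0) oU (BU _ Bx) fU (g_subgradient o x).
have [M0 fx0] := (ltW M_gt0, ltW fx); have [e0 v1] := (ltW eps_gt0, ltW v0).
rewrite ler_sqr ?nnegrE ?divr_ge0//.
by apply: ler_pM; rewrite ?invr_ge0 ?lef_pV2 ?posrE// ltW.
Qed.

Lemma polyakFM_ball w k : B (polyakFM f g sel x0 w k).
Proof.
rewrite /eucl_ball/= -ler_sqr ?nnegrE ?eucl_norm_ge0//.
by elim: k => [//|k IH] /=; exact: le_trans (polyak_step_closer _ _) IH.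
Qed.

(** The iterations for which [polyak_step_progress] guarantees a decrease;
    iteration [j + 1] draws the minibatch [w j]. *)
Definition violations (w : nat -> L.-tuple T) (k : nat) : nat :=
  \sum_(j < k)
     [exists l, eps < f (tnth (w j) l) (polyakFM f g sel x0 w j)]%R.

Lemma polyakFM_potential w k :
  eucl_norm (polyakFM f g sel x0 w k - z0) ^+ 2 <=
  eucl_norm (x0 - z0) ^+ 2 - (violations w k)%:R * (eps / M) ^+ 2.
Proof.
elim: k => [|k IH]; first by rewrite /violations big_ord0 mul0r subr0.
rewrite /violations big_ord_recr/= -/(violations w k) natrD mulrDl opprD addrA.
case: existsP => [[l fl]|_]; last first.
  by rewrite mul0r subr0; exact: le_trans (polyak_step_closer _ _) IH.
rewrite mul1r; apply: le_trans (polyak_step_progress (polyakFM_ball w k) fl) _.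
by rewrite lerD2r.
Qed.

(** As long as the current iterate violates some constraint by more than
    [eps], it is farther than [eps / M] from the feasible point [z0], which
    leaves room for one more unit of progress. *)
Lemma violations_lt w k o : eps < f o (polyakFM f g sel x0 w k) ->
  (violations w k).+1%:R < (M * eucl_norm (x0 - z0) / eps) ^+ 2.
Proof.
move=> epsf; have Bx := polyakFM_ball w k.
have [U [_ BU fU]] := f_lipschitz o.
have Bz : B z0.
  rewrite /eucl_ball/= subrr -(scale0r 0) eucl_normZ normr0 mul0r.
  exact: eucl_norm_ge0.
have eM0 : 0 < eps / M by rewrite divr_gt0.
have far : eps / M < eucl_norm (polyakFM f g sel x0 w k - z0).
  rewrite ltr_pdivrMr// mulrC; apply: lt_le_trans (fU _ _ (BU _ Bx) (BU _ Bz)).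
  apply: lt_le_trans (ler_norm _); rewrite (lt_le_trans epsf)// lerDl oppr_ge0.
  exact: z0_feasible.
have {}far : (eps / M) ^+ 2 < eucl_norm (polyakFM f g sel x0 w k - z0) ^+ 2.
  by rewrite ltr_sqr ?nnegrE ?eucl_norm_ge0// ltW.
have := lt_le_trans far (polyakFM_potential w k).
rewrite ltrBrDr -[X in X + _]mul1r -mulrDl addrC natr1.
rewrite -ltr_pdivlMr ?exprn_gt0// -expr_div_n.
by congr (_ < _ ^+ 2); field; rewrite !gt_eqF.
Qed.

End polyak_run.

(** * Joint measurability of the constraints *)

Lemma ball_rat_mx (R : realType) n (x : 'rV[R]_n) (e : R) :
  0 < e -> exists q : 'rV[rat]_n, ball x e (map_mx ratr q).
Proof.
move=> e0.
have /choice[q qx] (j : 'I_n) : exists q, ball (x 0 j) e (ratr q).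
  have /rat_in_itvoo[q] : x 0 j - e < x 0 j + e by lra.
  by rewrite in_itv/= => xqe; exists q; rewrite /ball/= ltr_distlC.
exists (\row_j q j); split=> // i j; rewrite !mxE (ord1 i); exact: qx.
Qed.

Lemma eucl_norm_lt_ball (R : realType) n (x y : 'rV[R]_n) (e : R) :
  ball x (e / n.+1%:R) y -> eucl_norm (x - y) < e.
Proof.
move=> [d0 xy]; have n0 : (0 : R) < n.+1%:R by [].
have e0 : 0 < e by rewrite -(divfK (lt0r_neq0 n0) e) mulr_gt0.
rewrite -ltr_sqr ?nnegrE ?eucl_norm_ge0 ?(ltW e0)// sqr_eucl_norm.
apply: (@le_lt_trans _ _ (\sum_(i < n) (e / n.+1%:R) ^+ 2)).
  apply: ler_sum => i _; rewrite -expr2 -real_normK ?num_real//.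
  rewrite ler_sqr ?nnegrE ?(ltW d0)// ltW//.
  by have := xy 0 i; rewrite /ball/= !mxE.
rewrite sumr_const card_ord expr_div_n -[_ *+ n]mulr_natl mulrCA.
rewrite gtr_pMr ?exprn_gt0// ltr_pdivrMr ?exprn_gt0// mul1r -natrX ltr_nat.
by rewrite (leq_trans (ltnSn n))// leq_pmulr.
Qed.

Lemma ex_natSinv_lt (R : realType) (e : R) : 0 < e -> exists m, m.+1%:R^-1 < e.
Proof.
by move=> e0; have [m _ /(_ m (leqnn m))] := near_infty_natSinv_lt (PosNum e0);
  exists m.
Qed.

(** The rational points need not meet [B], hence the choice of a point of [B]
    near each rational point that has one. *)
Lemma ex_countable_dense (R : realType) n (B : set 'rV[R]_n) :
  exists y : nat -> 'rV[R]_n, forall x e, B x -> 0 < e ->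
    exists2 k, B (y k) & eucl_norm (x - y k) < e.
Proof.
pose near_q (p : 'rV[rat]_n * nat) :=
  [set z | B z /\ ball z p.2.+1%:R^-1 (map_mx ratr p.1 : 'rV[R]_n)].
exists (fun k => oapp (fun p => xget 0 (near_q p)) 0 (choice.unpickle k)).
move=> x e Bx e0.
have /ex_natSinv_lt[m me] : 0 < e / n.+1%:R / 2 by rewrite !divr_gt0.
have [q xq] : exists q : 'rV[rat]_n, ball x m.+1%:R^-1 (map_mx ratr q).
  by apply: ball_rat_mx; rewrite invr_gt0.
have near_neq0 : near_q (q, m) x by [].
exists (choice.pickle (q, m)); rewrite choice.pickleK/=;
  have [Bz zq] := xgetPex 0 (ex_intro _ x near_neq0).
  by [].
apply: eucl_norm_lt_ball; rewrite [X in ball _ X](splitr (e / n.+1%:R)).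
by apply: ball_triangle; [exact: le_ball (ltW me) _ xq
  | exact/ball_sym/(le_ball (ltW me) zq)].
Qed.

Lemma measurable_coord (R : realType) n (i : 'I_n) :
  measurable_fun setT (fun x : measurable_rV R n => x 0 i).
Proof.
move=> _ A mA; rewrite setTI; do 2 apply: sub_sigma_algebra.
case: n i => [[]//|n] i; rewrite -bigcup_mkord_ord; exists i => //=.
by exists A => //; rewrite setTI inord_val.
Qed.

Lemma measurable_eucl_norm (R : realType) n (c : 'rV[R]_n) :
  measurable_fun setT (fun x : measurable_rV R n => eucl_norm (x - c)).
Proof.
apply: measurableT_comp (continuous_measurable_fun (@sqrt_continuous R)) _.
apply: measurable_sum => i.
have mi : measurable_fun setT (fun x : measurable_rV R n => (x - c) 0 i).
  rewrite (_ : (fun x => _) = fun x : measurable_rV R n => x 0 i - c 0 i).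
    by apply: measurable_funD => //; exact: measurable_coord.
  by apply/funext => x; rewrite mxE [X in _ + X]mxE.
exact: measurable_funM.
Qed.

(** A function that is measurable in [w] and Lipschitz in [x] on [B] is
    determined by its values at countably many points of [B]. *)
Lemma measurable_sublevel (R : realType) n (d : measure_display)
    (T : measurableType d) (f : T -> 'rV[R]_n -> R) (M eps : R)
    (B : set (measurable_rV R n)) :
  0 < M -> measurable B -> (forall x, measurable_fun setT (fun w => f w x)) ->
  (forall w, eucl_lipschitz_on M B (f w)) ->
  measurable [set xw : measurable_rV R n * T | B xw.1 /\ f xw.2 xw.1 <= eps].
Proof.
move=> M0 mB mf flip; have [y yB] := ex_countable_dense B.
pose D m k : set (measurable_rV R n * T) := if `[< B (y k) >] then
  [set x | M * eucl_norm (x - y k) < m.+1%:R^-1]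
    `*` [set w | f w (y k) <= eps + m.+1%:R^-1] else set0.
have -> : [set xw : measurable_rV R n * T | B xw.1 /\ f xw.2 xw.1 <= eps] =
    B `*` setT `&` \bigcap_m \bigcup_k D m k.
  apply/seteqP; split=> [[x w] /= [Bx fx]|[x w] /= [[Bx _] Dx]].
    split=> // m _.
    have [|k By xy] := yB x (m.+1%:R^-1 / M) Bx; first by rewrite divr_gt0.
    have xyM : M * eucl_norm (x - y k) < m.+1%:R^-1.
      by rewrite mulrC -ltr_pdivlMr.
    exists k => //; rewrite /D asboolT//; split=> //=.
    have := flip w _ _ By Bx; rewrite -[y k - x]opprB eucl_normN => /ler_normlW fxy.
    by move: (m.+1%:R^-1 : R) xyM => r xyM; lra.
  split=> //; rewrite leNgt; apply/negP => fx.
  have /ex_natSinv_lt[m] : 0 < (f w x - eps) / 2 by rewrite divr_gt0// subr_gt0.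
  have [k _] := Dx m I; rewrite /D; case: asboolP => // By [/= xyM fy] rm.
  have := flip w _ _ Bx By => /ler_normlW fxy.
  by move: (m.+1%:R^-1 : R) xyM fy rm => r xyM fy rm; lra.
apply: measurableI; first exact: measurableX.
apply: bigcapT_measurable => m; apply: bigcupT_measurable => k.
rewrite /D; case: ifP => // _; apply: measurableX.
  rewrite -[X in measurable X]setTI.
  apply: (measurable_fun_ltr _ _ measurableT) => //.
  apply: measurable_funM => //; exact: measurable_eucl_norm.
rewrite -[X in measurable X]setTI.
exact: (measurable_fun_ler _ _ measurableT).
Qed.

(** * Conditioning on the past *)

(** The sets of this form, for fixed [J], are stable under intersection and
    generate the information carried by the [X i] with [i] in [J]. *)
Definition history d (T : measurableType d) (S : Type) (I : choiceType)
    (X : I -> S -> T) (J : {fset I}) : set (set S) :=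
  [set \bigcap_(i in [set` J]) X i @^-1` A i |
    A in [set A : I -> set T | forall i, measurable (A i)]].

Notation historyType X J := (g_sigma_algebraType (history X J)).

Section independence.
Variables (R : realType) (d d' : measure_display).
Variables (S : measurableType d) (T : measurableType d').
Variables (Q : probability S R) (I : choiceType) (X : I -> S -> T).
Hypothesis mX : forall i, measurable_fun setT (X i).
Hypothesis X_indep : mutually_independent Q X.

Lemma setI_closed_history J : setI_closed (history X J).
Proof.
move=> _ _ [A mA <-] [B mB <-]; exists (fun i => A i `&` B i).
  by move=> i; exact: measurableI.
by rewrite -bigcapI.
Qed.

Lemma measurable_history J (F : set (historyType X J)) :
  measurable F -> measurable (F : set S).
Proof.
apply: smallest_sub; first exact: sigma_algebra_measurable.
move=> _ [A mA <-]; apply: fin_bigcap_measurable => // i _.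
by rewrite -[X in measurable X]setTI; exact: mX.
Qed.

Lemma measurable_fun_history J i : i \in J ->
  measurable_fun setT (X i : historyType X J -> T).
Proof.
move=> iJ _ A mA; rewrite setTI; apply: sub_sigma_algebra.
exists (fun j => if j == i then A else setT).
  by move=> j; case: ifP.
apply/seteqP; split => [s /(_ i iJ)|s As j _] /=; first by rewrite eqxx.
by case: eqP => [->|].
Qed.

(** On a generating intersection over [J] the product rule is mutual
    independence of the variables indexed by [J] and [c]; Dynkin's theorem
    extends it to the whole history. *)
Lemma history_independent J c (F : set (historyType X J)) (B : set T) :
  c \notin J -> measurable F -> measurable B ->
  Q (F `&` X c @^-1` B) = (Q F * Q (X c @^-1` B))%E.
Proof.
move=> cJ mF mB.
have mXB : measurable (X c @^-1` B).
  by rewrite -[X in measurable X]setTI; exact: mX.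
have fin (G : set S) : measurable G -> Q G = (fine (Q G))%:E.
  by move=> mG; rewrite fineK// fin_num_measure.
have [//] : measurable F /\ Q (F `&` X c @^-1` B) = (Q F * Q (X c @^-1` B))%E.
move: F mF; apply: dynkin_induction => //.
- exact: setI_closed_history.
- by split=> //; rewrite setTI probability_setT mul1e.
- move=> F HF; split; first exact: sub_sigma_algebra.
  move: HF => [A mA <-].
  pose A' i := if i == c then B else A i.
  have mA' i : measurable (A' i) by rewrite /A'; case: ifP.
  have A'E i : i \in J -> A' i = A i.
    by rewrite /A'; case: eqP => // ->; rewrite (negbTE cJ).
  have -> : \bigcap_(i in [set` J]) X i @^-1` A i `&` X c @^-1` B =
      \bigcap_(i in [set` c |` J]%fset) X i @^-1` A' i.
    apply/seteqP; split=> [s [AJ Bc] i /=|s A's /=].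
      rewrite inE => /orP[|iJ]; last by rewrite (A'E _ iJ); exact: AJ.
      by rewrite inE => /eqP ->; rewrite /A' eqxx.
    split=> [i /= iJ|].
      by rewrite -(A'E _ iJ); apply: A's; rewrite /= inE iJ orbT.
    by have := A's c; rewrite /A' eqxx /=; apply; rewrite inE inE eqxx.
  rewrite !X_indep// big_fsetU1//= [in LHS]/A' eqxx.
  rewrite (fin (X c @^-1` B))// -EFinM mulrC; congr (_ * _)%:E.
  by apply: eq_big_seq => i iJ; rewrite -[if _ then _ else _]/(A' i) A'E.
- move=> F mF [_ QF]; split; first exact: measurableC.
  have mF' := measurable_history mF.
  rewrite setIC -setDE measureD//; last first.
    by rewrite ltey_eq fin_num_measure.
  rewrite setIC [X in (_ - X)%E]QF probability_setC//.
  rewrite (fin (X c @^-1` B))// (fin F)// [X in (X - _)%E](fin _ mXB).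
  by rewrite -!EFinM -EFinB mulrBl mul1r.
- move=> F mF tF HF; split; first exact: bigcup_measurable.
  have mF' i := measurable_history (mF i).
  rewrite setI_bigcupl measure_bigcup//=; last 2 first.
  + by move=> i _; exact: measurableI.
  + exact: trivIset_setIr.
  rewrite measure_bigcup//= muleC (fin _ mXB) -nneseriesZl//.
  by apply: eq_eseriesr => i _; have [_ ->] := HF i; rewrite muleC -fin.
Qed.

End independence.

(** Integrate over [Y] first: by independence the joint law of [Y] and [W] is a
    product measure, for which the bound on the sections of [E] suffices. *)
Lemma section_bound (R : realType) (d d1 d2 : measure_display)
    (S : measurableType d) (T1 : measurableType d1) (T2 : measurableType d2)
    (Q : probability S R) (P : probability T2 R)
    (Y : {mfun S >-> T1}) (W : {mfun S >-> T2})
    (F : set T1) (E : set (T1 * T2)) (c : R) :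
  (forall A B, measurable A -> measurable B ->
     Q (Y @^-1` A `&` W @^-1` B) = (Q (Y @^-1` A) * P B)%E) ->
  measurable F -> measurable E ->
  (forall y w, E (y, w) -> F y) ->
  (forall y, F y -> (P (xsection E y) <= c%:E)%E) -> 0 <= c ->
  (Q [set s | E (Y s, W s)] <= c%:E * Q (Y @^-1` F))%E.
Proof.
move=> YW mF mE EF Ec c0.
have mYW : measurable_fun setT (fun s => (Y s, W s)).
  exact: measurable_fun_pair.
pose YWm : {mfun S >-> (T1 * T2)%type} := mfun_Sub (mem_set mYW).
have <- : (distribution Q Y \x P)%E E = Q [set s | E (Y s, W s)].
  by apply: (@product_measure_unique _ _ _ _ _ (distribution Q Y) P
    (distribution Q YWm)).
rewrite /product_measure1/=.
apply: (@le_trans _ _ (\int[distribution Q Y]_y (c%:E * (\1_F y)%:E))%E).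
  apply: ge0_le_integral => //.
  - exact: measurable_fun_xsection.
  - exact/measurable_funeM/measurable_EFinP.
  - move=> y _ /=; rewrite indicE; have [/set_mem/Ec|/negP Fy] := boolP (y \in F).
      by rewrite mule1.
    rewrite mule0 (_ : xsection E y = set0) ?measure0//.
    by rewrite -subset0 => w /xsectionP/EF/mem_set.
rewrite ge0_integralZl//; first last.
- by apply/measurable_EFinP.
by rewrite integral_indic// setIT.
Qed.

(** * Counting successes of dependent trials *)

Section success_count.
Variables (R : realType) (d : measure_display) (S : measurableType d).
Variables (Q : probability S R) (p : R) (A : nat -> set S).
Variables (V : nat -> S -> nat) (success : nat -> S -> bool).
Hypotheses (p_gt0 : 0 < p) (p_lt1 : p < 1).
Hypotheses (mA : forall k, measurable (A k)) (A_anti : forall k, A k.+1 `<=` A k).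
Hypothesis mV : forall k j, measurable [set s | V k s = j].
Hypothesis V0 : forall s, V 0 s = 0%N.
Hypothesis VS : forall k s, V k.+1 s = (V k s + success k s)%N.
Hypothesis success_prob : forall k j,
  (Q (A k `&` [set s | V k s = j] `&` [set s | ~~ success k s]) <=
   (1 - p)%:E * Q (A k `&` [set s | V k s = j]))%E.

Let mAV k j : measurable (A k `&` [set s | V k s = j]).
Proof. exact: measurableI. Qed.

Let mV_lt k j : measurable [set s | (V k s < j)%N].
Proof.
rewrite (_ : [set s | _] = \bigcup_(i in [set i | (i < j)%N]) [set s | V k s = i]).
  by apply: bigcup_measurable => i _; exact: mV.
by apply/seteqP; split=> [s Vs|s [i ij Vs]]; [exists (V k s)|rewrite /= Vs].
Qed.

Let msucc k j :
  measurable (A k `&` [set s | V k s = j] `&` [set s | ~~ success k s]).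
Proof.
rewrite -setIA (_ : [set s | V k s = j] `&` _ =
  [set s | V k s = j] `&` [set s | V k.+1 s = j]).
  by apply: measurableI => //; exact: measurableI.
apply/seteqP; split=> s [/= Vk].
  by rewrite VS Vk => /negbTE ->; rewrite addn0.
by rewrite VS Vk; case: success => //; rewrite addn1 => /esym/n_Sn.
Qed.

(** Each trial that takes place on [A k] succeeds with conditional probability
    at least [p], hence few successes are at most as likely as for independent
    trials: conditioning on the last trial shows that the left-hand side is
    bounded by the recursion [binom_tail_rec] of the right-hand side. *)
Lemma success_count_tail k j :
  (Q (A k `&` [set s | (V k s < j)%N]) <= (binom_tail p k j)%:E)%E.
Proof.
elim: k j => [|k IH] [|j].
- rewrite (_ : _ `&` _ = set0) ?measure0 ?lee_fin ?binom_tail_ge0//.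
  by rewrite -subset0 => s [].
- by rewrite binom_tail_zero probability_le1//; exact: measurableI.
- rewrite (_ : _ `&` _ = set0) ?measure0 ?lee_fin ?binom_tail_ge0//.
  by rewrite -subset0 => s [].
have mlt i : measurable (A k `&` [set s | (V k s < i)%N]) by exact: measurableI.
have split_lt : Q (A k `&` [set s | (V k s < j.+1)%N]) =
    (Q (A k `&` [set s | (V k s < j)%N]) + Q (A k `&` [set s | V k s = j]))%E.
  rewrite -measureU//; last first.
    by rewrite -subset0 => s [[_ /= Vs] [_ /= Vj]]; rewrite Vj ltnn in Vs.
  congr (Q _); rewrite -setIUr; congr (_ `&` _); apply/seteqP; split=> s /=.
    by rewrite ltnS leq_eqVlt => /orP[/eqP|]; [right|left].
  by case=> [/leqW//|->].
have le_split : (Q (A k.+1 `&` [set s | (V k.+1 s < j.+1)%N]) <=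
    Q (A k `&` [set s | (V k s < j)%N]) +
    Q (A k `&` [set s | V k s = j] `&` [set s | ~~ success k s]))%E.
  rewrite -measureU//; last first.
    by rewrite -subset0 => s [[_ /= Vs] [[_ /= Vj] _]]; rewrite Vj ltnn in Vs.
  apply: le_measure; rewrite ?inE.
  - exact: measurableI.
  - exact: measurableU.
  move=> s [/A_anti As /=]; rewrite VS ltnS.
  case: (boolP (success k s)) => Hs; first by rewrite addn1 => Vs; left.
  by rewrite addn0 leq_eqVlt => /orP[/eqP|]; [right|left].
apply: (le_trans le_split).
have := success_prob k j; have := IH j.+1; have := IH j.
rewrite split_lt binom_tail_rec.
have fin E : measurable E -> Q E = (fine (Q E))%:E.
  by move=> mE; rewrite fineK// fin_num_measure.
rewrite (fin (A k `&` [set s | (V k s < j)%N]))// (fin _ (mAV k j)).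
rewrite (fin _ (msucc k j)) -EFinM -!EFinD !lee_fin.
move: (fine _) (fine _) (fine _) => c b a.
move: p_gt0 p_lt1 => p0 p1 aj abj cb.
have := ler_wpM2l (ltW p0) aj.
have : (1 - p) * (a + b) <= (1 - p) * binom_tail p k j.+1.
  by rewrite ler_wpM2l// subr_ge0 ltW.
lra.
Qed.

End success_count.

(** * First hitting times *)

Lemma first_timeE (R : realType) (good : set nat) :
  first_time R good =
  (\sum_(k <oo) (\1_[set i | forall j, (j <= i)%N -> ~ good j] k)%:E)%E.
Proof.
set waiting := [set i | _].
have [[k gk]|no_good] := pselect (exists k, good k); last first.
  have -> : first_time R good = +oo%E.
    rewrite /first_time (_ : [set _ | _ in _] = set0) ?ereal_inf0//.
    by rewrite -subset0 => t [k gk _]; case: no_good; exists k.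
  apply/esym/eqyP => r r0.
  have [m _ /(_ m (leqnn m)) rm] := nbhs_infty_ger r.
  apply: (@le_trans _ _ m%:R%:E); first by rewrite lee_fin.
  apply: le_trans (nneseries_lim_ge m _); last by move=> i _; rewrite lee_fin.
  rewrite (eq_bigr (fun=> 1%E)); last first.
    move=> i _; rewrite indicE mem_set// => j _ gj; apply: no_good.
    by exists j.
  by rewrite big_mkord sumEFin sumr_const card_ord.
have /ex_minnP[m /asboolP gm m_min] : exists k, `[< good k >].
  by exists k; apply/asboolP.
have -> : first_time R good = m%:R%:E.
  apply/eqP; rewrite eq_le; apply/andP; split.
    by apply: ereal_inf_lbound; exists m.
  apply: le_ereal_inf_tmp => _ [j gj <-]; rewrite lee_fin ler_nat.
  by apply: m_min; apply/asboolP.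
rewrite (nneseries_split 0 m); last by move=> i _; rewrite lee_fin.
rewrite add0n eseries0 ?adde0; last first.
  move=> i mi _; rewrite indicE memNset// => /(_ m mi); exact.
rewrite (eq_big_nat _ _ (F2 := fun=> 1%E)); last first.
  move=> i /andP[_ im]; rewrite indicE mem_set// => j ji gj.
  by have := m_min j (introT (asboolP _) gj); rewrite leqNgt (leq_ltn_trans ji im).
by rewrite big_mkord sumEFin sumr_const card_ord.
Qed.

(** The expectation of a hitting time is the sum of the probabilities of still
    waiting. *)
Lemma expected_first_time_le (R : realType) (d : measure_display)
    (S : measurableType d) (Q : probability S R) (good : S -> set nat)
    (c : nat -> R) (C : R) :
  let waiting k := [set s | forall j, (j <= k)%N -> ~ good s j] in
  (forall k, measurable (waiting k)) -> (forall k, Q (waiting k) <= (c k)%:E)%E ->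
  (forall m, \sum_(k < m) c k <= C) ->
  (\int[Q]_s first_time R (good s) <= C%:E)%E.
Proof.
move=> waiting mwaiting Qc cC.
rewrite (eq_integral (fun s => \sum_(k <oo) (\1_(waiting k) s)%:E)%E); last first.
  by move=> s _; rewrite first_timeE.
rewrite integral_nneseries//; last by move=> k; apply/measurable_EFinP.
apply: lime_le.
  by apply: is_cvg_nneseries => k _ _; apply: integral_ge0 => s _;
    rewrite lee_fin.
apply: nearW => m; rewrite big_mkord.
apply: (@le_trans _ _ (\sum_(k < m) (c k)%:E)%E).
  by apply: lee_sum => k _; rewrite integral_indic// setIT; exact: Qc.
by rewrite sumEFin lee_fin.
Qed.

(** * The random run *)

Section random_run.
Variables (R : realType) (n : nat) (d : measure_display) (T : measurableType d).
Variables (P : probability T R) (f : T -> 'rV[R]_n -> R).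
Variables (g : T -> 'rV[R]_n -> 'rV[R]_n) (M : R) (x0 z0 : 'rV[R]_n).
Variables (L : nat) (sel : 'rV[R]_n -> L.-tuple T -> 'I_L).
Variables (d' : measure_display) (S : measurableType d') (Q : probability S R).
Variables (W : nat -> 'I_L -> {RV Q >-> T}) (Gamma eps : R).
Hypotheses (M_gt0 : 0 < M) (eps_gt0 : 0 < eps) (z0_feasible : feasible f z0).
Hypothesis f_measurable : forall x, measurable_fun setT (fun w => f w x).
Hypothesis f_lipschitz : forall w, exists U : set 'rV[R]_n,
  [/\ open U, eucl_ball z0 (eucl_norm (x0 - z0)) `<=` U
    & eucl_lipschitz_on M U (f w)].
Hypothesis g_subgradient : forall w x, subdifferential (f w) x (g w x).
Hypothesis sel_argmax : argmax_rule f sel.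
Hypothesis step_measurable : measurable_fun setT
  (fun xw : measurable_rV R n * L.-tuple T =>
     polyak_step f g sel xw.1 xw.2 : measurable_rV R n).
Hypothesis W_law : forall k l (A : set T), measurable A ->
  distribution Q (W k l) A = P A.
Hypothesis W_indep : mutually_independent Q
  (fun kl : nat * 'I_L => W kl.1 kl.2 : S -> T).
Hypotheses (L_gt0 : (0 < L)%N) (Gamma_gt0 : 0 < Gamma) (Gamma_lt1 : Gamma < 1).

Let X (kl : nat * 'I_L) : S -> T := W kl.1 kl.2.
Let minibatch (s : S) (j : nat) : L.-tuple T := [tuple W j l s | l < L].
Let x (s : S) (k : nat) : 'rV[R]_n := polyakFM f g sel x0 (minibatch s) k.
Let good (s : S) : set nat :=
  [set k | ((1 - Gamma)%:E <= P (Omega_eps f (x s k) eps))%E].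

Let B : set (measurable_rV R n) := eucl_ball z0 (eucl_norm (x0 - z0)).
Let sublevel : set (measurable_rV R n * T) :=
  [set xw | B xw.1 /\ f xw.2 xw.1 <= eps].
(** Restricted to [B], where joint measurability is available; the iterates stay
    there. *)
Let bad : set (measurable_rV R n) :=
  B `&` [set y | (P (xsection sublevel y) < (1 - Gamma)%:E)%E].

Let waiting k : set S := [set s | forall j, (j <= k)%N -> ~ good s j].
Let V k s := violations f g sel eps x0 (minibatch s) k.
Let success k s := [exists l, eps < f (W k l s) (x s k)].

(** The samples drawn before the [m]-th sample of iteration [k + 1]. *)
Definition past (k m : nat) : {fset nat * 'I_L} :=
  [fset b in [seq (i, l) | i <- iota 0 k.+1, l <- enum 'I_L] |
    (b.1 < k)%N || (b.1 == k) && (b.2 < m)%N]%fset.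

Lemma in_past k m b :
  (b \in past k m) = (b.1 < k)%N || (b.1 == k) && (b.2 < m)%N.
Proof.
case: b => i l; rewrite !inE andb_idl//.
move=> H; apply/allpairsPdep; exists i, l; rewrite mem_enum mem_iota add0n /=.
by split=> //; case/orP: H => /= [/leqW//|/andP[/eqP -> _]].
Qed.

Let mX b : measurable_fun setT (X b). Proof. exact: measurable_funPT. Qed.

Let in_B s k : B (x s k).
Proof. exact: polyakFM_ball. Qed.

Let measurable_B : measurable B.
Proof.
rewrite -[X in measurable X]setTI.
apply: (measurable_fun_ler _ _ measurableT) => //.
exact: measurable_eucl_norm.
Qed.

Let measurable_sub : measurable sublevel.
Proof.
apply: measurable_sublevel M_gt0 measurable_B f_measurable _ => w u v Bu Bv.
by have [U [_ BU fU]] := f_lipschitz w; apply: fU; exact: BU.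
Qed.

Let xsection_sublevel y : B y -> xsection sublevel y = Omega_eps f y eps.
Proof.
move=> By; apply/seteqP; split=> [w /xsectionP[]//|w fw].
by apply/xsectionP; split.
Qed.

Let badP s k : bad (x s k) <-> ~ good s k.
Proof.
rewrite /bad /good/= xsection_sublevel//; split=> [[_]|].
  by rewrite ltNge => /negP.
by move=> /negP; rewrite -ltNge.
Qed.

Let measurable_bad : measurable bad.
Proof.
apply: measurableI => //.
have := measurable_fun_xsection P measurable_sub measurableT
  (emeasurable_itv `]-oo, (1 - Gamma)%:E[).
by rewrite setTI.
Qed.

Let measurable_x J k : (forall b, (b.1 < k)%N -> b \in J) ->
  measurable_fun setT
    (fun s : historyType X J => x s k : measurable_rV R n).
Proof.
elim: k => [|k IH] kJ; first exact: measurable_cst.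
have mpair : measurable_fun setT (fun s : historyType X J =>
    (x s k : measurable_rV R n, minibatch s k)).
  apply: measurable_fun_pair.
    by apply: IH => b bk; apply: kJ; exact: leqW.
  apply/measurable_fun_tnthP => l; rewrite (_ : _ \o _ = X (k, l)).
    by apply: measurable_fun_history => //; exact: kJ.
  by apply/funext => s /=; rewrite tnth_mktuple.
exact: (measurableT_comp step_measurable mpair).
Qed.

Let measurable_waiting k m :
  measurable (waiting k : set (historyType X (past k m))).
Proof.
rewrite (_ : waiting k = \bigcap_(j in [set j | (j <= k)%N])
    (fun s => x s j) @^-1` bad); last first.
  apply/seteqP; split=> [s sk j jk|s sk j jk]; first exact/badP/sk.
  exact/badP/sk.
apply: bigcap_measurable => [|j jk]; first by exists k => /=.
rewrite -[X in measurable X]setTI; apply: measurable_x => // b bj.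
by rewrite in_past (leq_trans bj).
Qed.

Let measurable_le J k l : (forall b, (b.1 < k)%N -> b \in J) -> (k, l) \in J ->
  measurable ([set s | f (W k l s) (x s k) <= eps] : set (historyType X J)).
Proof.
move=> kJ klJ.
have mp : measurable_fun setT
    (fun s : historyType X J => (x s k : measurable_rV R n, X (k, l) s)).
  by apply: measurable_fun_pair; [exact: measurable_x|
    exact: measurable_fun_history].
have := mp measurableT _ measurable_sub; rewrite setTI.
congr measurable; apply/seteqP; split=> [s []//|s fs]; split=> //.
exact: in_B.
Qed.

Let no_successE k s :
  ~~ success k s <-> forall l, f (W k l s) (x s k) <= eps.
Proof.
rewrite negb_exists; split=> [/forallP + l|fs].
  by move=> /(_ l); rewrite -leNgt.
by apply/forallP => l; rewrite -leNgt.
Qed.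

Let measurable_success J k : (forall b, (b.1 <= k)%N -> b \in J) ->
  measurable ([set s | ~~ success k s] : set (historyType X J)).
Proof.
move=> kJ; rewrite (_ : [set s | _] =
  \bigcap_(l in [set: 'I_L]) [set s | f (W k l s) (x s k) <= eps]); last first.
  apply/seteqP; split=> [s /no_successE fs l _|s fs]; first exact: fs.
  by apply/no_successE => l; exact: fs.
apply: fin_bigcap_measurable => // l _; apply: measurable_le; last exact: kJ.
by move=> b /ltnW; exact: kJ.
Qed.

Let VS k s : V k.+1 s = (V k s + success k s)%N.
Proof.
rewrite /V /violations big_ord_recr/=; congr (_ + nat_of_bool _)%N.
by apply: eq_existsb => l; rewrite tnth_mktuple.
Qed.

Let measurable_V J k j : (forall b, (b.1 < k)%N -> b \in J) ->
  measurable ([set s | V k s = j] : set (historyType X J)).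
Proof.
elim: k j => [|k IH] j kJ.
  rewrite (_ : [set s | _] = if (0 == j)%N then setT else set0).
    by case: ifP.
  by apply/seteqP; split=> s /=; rewrite /V /violations big_ord0; case: eqP.
have kJ' b : (b.1 < k)%N -> b \in J by move=> bk; apply: kJ; exact: leqW.
have mV i := IH i kJ'; have ms := measurable_success kJ.
rewrite (_ : [set s | _] =
    ([set s | V k s = j] `&` [set s | ~~ success k s]) `|`
    ([set s | (V k s).+1 = j] `&` ~` [set s | ~~ success k s])).
  apply: measurableU; first exact: measurableI.
  apply: measurableI; last exact: measurableC.
  case: j => [|j]; first by rewrite (_ : [set s | _] = set0)// -subset0.
  rewrite (_ : [set s | _] = [set s | V k s = j])//.
  by apply/seteqP; split=> s /=; [case|move=> ->].
apply/seteqP; split=> s /=; rewrite VS; case: success => /=.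
- by rewrite addn1 => <-; right.
- by rewrite addn0 => <-; left.
- by rewrite addn1 => -[[]|[]].
- by rewrite addn0 => -[[]//|[_]].
Qed.

(** Among the outcomes still waiting, each new sample respects the current
    iterate up to [eps] with conditional probability below [1 - Gamma],
    because that iterate is determined by the earlier samples and is bad. *)
Let sample_bound k m (F : set (historyType X (past k m))) (ltmL : (m < L)%N) :
  measurable F -> F `<=` waiting k ->
  (Q (F `&` [set s | f (W k (Ordinal ltmL) s) (x s k) <= eps]%R) <=
   (1 - Gamma)%:E * Q F)%E.
Proof.
move=> mF Fk; set l := Ordinal ltmL.
have mid : measurable_fun setT (idfun : S -> historyType X (past k m)).
  by move=> _ A mA; rewrite setTI; exact: (measurable_history mX mA).
pose Y : {mfun S >-> historyType X (past k m)} := mfun_Sub (mem_set mid).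
pose E : set (historyType X (past k m) * T) :=
  [set sw | F sw.1 /\ f sw.2 (x sw.1 k) <= eps].
have mE : measurable E.
  have mxw : measurable_fun setT (fun sw : historyType X (past k m) * T =>
      (x sw.1 k : measurable_rV R n, sw.2)).
    apply: measurable_fun_pair => //.
    have mxk : measurable_fun setT
        (fun s : historyType X (past k m) => x s k : measurable_rV R n).
      by apply: measurable_x => b bk; rewrite in_past bk.
    exact: (measurableT_comp mxk measurable_fst).
  rewrite (_ : E = (F `*` setT) `&` (setT `&`
    (fun sw => (x sw.1 k : measurable_rV R n, sw.2)) @^-1` sublevel)).
    by apply: measurableI; [exact: measurableX|exact: mxw].
  rewrite setTI.
  apply/seteqP; split=> [[s w] [Fs fs]|[s w] [[Fs _] [_ fs]]]//.
  by split; split=> //; exact: in_B.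
have := @section_bound _ _ _ _ _ _ _ Q P Y (W k l) F E (1 - Gamma).
apply => //.
- move=> A C mA mC; rewrite -(W_law k l mC).
  apply: (history_independent mX W_indep (J := past k m) (c := (k, l))) => //.
  by rewrite in_past/= ltnn eqxx ltnn.
- by move=> s w [].
- move=> s Fs; have /badP[_ /ltW] := Fk s Fs k (leqnn k).
  apply: le_trans; apply: le_measure; rewrite ?inE.
  + exact: measurable_xsection.
  + exact: measurable_xsection.
  move=> w /xsectionP[_ fs]; apply/xsectionP; split => //; exact: in_B.
- by rewrite subr_ge0 ltW.
Qed.

Let all_samples_bound k j m : (m <= L)%N ->
  (Q (waiting k `&` [set s | V k s = j] `&`
      [set s | forall l : 'I_L, (l < m)%N -> f (W k l s) (x s k) <= eps]%R) <=
   ((1 - Gamma) ^+ m)%:E * Q (waiting k `&` [set s | V k s = j]))%E.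
Proof.
set F := waiting k `&` _; elim: m => [_|m IH mL].
  by rewrite expr0 mul1e (_ : [set s | _] = setT) ?setIT//; exact/seteqP.
pose F_ := F `&`
  [set s | forall l : 'I_L, (l < m)%N -> f (W k l s) (x s k) <= eps].
have mF : measurable (F_ : set (historyType X (past k m))).
  apply: measurableI.
    apply: measurableI; first exact: measurable_waiting.
    by apply: measurable_V => b bk; rewrite in_past bk.
  rewrite (_ : [set s | _] = \bigcap_(l in [set l : 'I_L | (l < m)%N])
    [set s | f (W k l s) (x s k) <= eps])//.
  apply: fin_bigcap_measurable => // l lm; apply: measurable_le.
    by move=> b bk; rewrite in_past bk.
  by rewrite in_past/= eqxx lm orbT.
have Fk : F_ `<=` waiting k by move=> s [[]].
have := sample_bound mL mF Fk.
rewrite (_ : F_ `&` _ =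
  F `&` [set s | forall l : 'I_L, (l < m.+1)%N -> f (W k l s) (x s k) <= eps]).
  move=> /le_trans; apply; rewrite exprS EFinM -muleA.
  by rewrite lee_pmul2l ?lte_fin ?subr_gt0//; exact: (IH (ltnW mL)).
apply/seteqP; split=> s /=.
  move=> [[Fs fs] fm]; split=> // l; rewrite ltnS leq_eqVlt => /orP[/eqP lm|/fs//].
  by rewrite (_ : l = Ordinal mL)//; exact: val_inj.
by move=> [Fs fs]; split; [split=> // l lm; apply: fs; exact: leqW|exact: fs].
Qed.

Let p := 1 - (1 - Gamma) ^+ L.

Let p_gt0 : 0 < p.
Proof. by rewrite subr_gt0 exprn_ilt1 ?subr_ge0 ?ltW ?gtrBl// -lt0n. Qed.

Let p_lt1 : p < 1.
Proof. by rewrite gtrBl exprn_gt0// subr_gt0. Qed.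

Let measurable_history_setT J (F : set (historyType X J)) :
  measurable F -> measurable (F : set S).
Proof. exact: (measurable_history mX). Qed.

Lemma measurable_waiting_time k : measurable (waiting k).
Proof. exact: (measurable_history mX (@measurable_waiting k 0)). Qed.

Lemma waiting_count_tail k j :
  (Q (waiting k `&` [set s | (V k s < j)%N]) <= (binom_tail p k j)%:E)%E.
Proof.
apply: (@success_count_tail _ _ _ Q p waiting V success) => //.
- exact: measurable_waiting_time.
- by move=> i s si l li; apply: si; exact: leqW.
- move=> i l; apply: (@measurable_history_setT (past i 0)).
  by apply: measurable_V => b bi; rewrite in_past bi.
- move=> i l; rewrite /p subKr.
  have := all_samples_bound i l (leqnn L); congr (_ <= _)%E.
  congr (Q (_ `&` _)); apply/seteqP; split=> s /=.
    by move=> fs; apply/no_successE => a; exact: fs.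
  by move=> /no_successE fs a _; exact: fs.
Qed.

(** The last of these iterates violates some constraint by more than [eps], so
    the potential argument leaves room for fewer than [m] successes. *)
Lemma waiting_tail k m :
  (M * eucl_norm (x0 - z0) / eps) ^+ 2 <= m.+1%:R ->
  (Q (waiting k) <= (binom_tail p k m)%:E)%E.
Proof.
move=> Nm; rewrite (_ : waiting k = waiting k `&` [set s | (V k s < m)%N]).
  exact: waiting_count_tail.
rewrite setIidl// => s /(_ k (leqnn k)) /badP bad_k.
have [w fw] : exists w, eps < f w (x s k).
  apply: contrapT => /forallNP no; case: bad_k => _ /=.
  rewrite xsection_sublevel// (_ : Omega_eps _ _ _ = setT); last first.
    apply/seteqP; split=> // w _; rewrite /Omega_eps/= leNgt.
    exact/negP/no.
  rewrite probability_setT lte_fin; apply/negP.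
  by rewrite -leNgt lerBlDr lerDl ltW.
have := violations_lt M_gt0 eps_gt0 z0_feasible f_lipschitz g_subgradient
  sel_argmax fw.
by move=> /lt_le_trans/(_ Nm); rewrite ltr_nat ltnS.
Qed.

End random_run.

(** * Hitting time of the good iterates *)

Theorem theorem2p1 (R : realType) (n : nat)
  (d : measure_display) (T : measurableType d) (P : probability T R)
  (f : T -> 'rV[R]_n -> R) (g : T -> 'rV[R]_n -> 'rV[R]_n)
  (M : R) (x0 z0 : 'rV[R]_n)
  (L : nat) (sel : 'rV[R]_n -> L.-tuple T -> 'I_L)
  (d' : measure_display) (S : measurableType d') (Q : probability S R)
  (W : nat -> 'I_L -> {RV Q >-> T})
  (Gamma eps : R)
  (f_convex : forall w, convex_function setT (f w))
  (f_measurable : forall x, measurable_fun setT (fun w => f w x))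
  (feasible_neq0 : feasible f !=set0)
  (z0_closest : closest_point (feasible f) x0 z0)
  (f_lipschitz : forall w, exists U : set 'rV[R]_n,
     [/\ open U, eucl_ball z0 (eucl_norm (x0 - z0)) `<=` U & eucl_lipschitz_on M U (f w)])
  (g_subgradient : forall w x, subdifferential (f w) x (g w x))
  (L_ge1 : (1 <= L)%N)
  (sel_argmax : argmax_rule f sel)
  (step_measurable : measurable_fun setT
     (fun xw : measurable_rV R n * L.-tuple T =>
        polyak_step f g sel xw.1 xw.2 : measurable_rV R n))
  (W_law : forall k l (A : set T), measurable A ->
     distribution Q (W k l) A = P A)
  (W_indep : mutually_independent Q
     (fun kl : nat * 'I_L => W kl.1 kl.2 : S -> T))
  (Gamma_gt0 : 0 < Gamma) (Gamma_lt1 : Gamma < 1)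
  (eps_gt0 : 0 < eps) (eps_lt : eps < M * eucl_dist x0 (feasible f)) :
  let p := 1 - (1 - Gamma) ^+ L in
  let E := 1 / p * (M * eucl_dist x0 (feasible f) / eps) ^+ 2 in
  let x (s : S) (k : nat) :=
    polyakFM f g sel x0 (fun j => [tuple W j l s | l < L]) k in
  let good (s : S) :=
    [set k | ((1 - Gamma)%:E <= P (Omega_eps f (x s k) eps))%E] in
  (\int[Q]_s first_time R (good s) <= E%:E)%E /\
  (forall k : nat, 2 * E <= k%:R ->
     (Q [set s | is_first (good s) k] <=
      (1 / 2 * (1 / (1 + 1 / 2 * (p / (1 - p)))) ^ (k%:Z - Num.ceil (2 * E)))%:E)%E).
Proof.
have distE := eucl_dist_closest z0_closest.
set D := eucl_dist x0 (feasible f) in distE *.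
have D_ge0 : 0 <= D by rewrite distE eucl_norm_ge0.
have MD_gt0 : 0 < M * D := lt_trans eps_gt0 eps_lt.
have D_gt0 : 0 < D.
  rewrite lt_def D_ge0 andbT; apply/eqP => D0.
  by rewrite D0 mulr0 ltxx in MD_gt0.
have M_gt0 : 0 < M by rewrite pmulr_lgt0 in MD_gt0.
move=> p E x good.
have q_gt0 : 0 < (1 - Gamma) ^+ L by rewrite exprn_gt0// subr_gt0.
have p_lt1 : p < 1 by rewrite gtrBl.
have p_gt0 : 0 < p.
  rewrite subr_gt0 exprn_ilt1 ?subr_ge0 ?(ltW Gamma_lt1)// ?gtrBl//.
  by rewrite -lt0n.
pose N := (M * D / eps) ^+ 2.
have N_gt0 : 0 < N by rewrite exprn_gt0// divr_gt0.
have EpN : E * p = N by rewrite /E div1r mulrC mulrA divff ?mul1r// gt_eqF.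
have E_gt0 : 0 < E by rewrite mulr_gt0// divr_gt0.
(* The strict bound [m < N], also for integral [N], matches [violations_lt]. *)
have [m mN Nm] : exists2 m : nat, m%:R < N & N <= m.+1%:R.
  have exN : exists i : nat, N <= i%:R.
    by exists (Num.bound N); rewrite ltW// archi_boundP// ltW.
  case: (ex_minnP exN) => -[|m] Nm min_m.
    by move: Nm; rewrite leNgt N_gt0.
  by exists m => //; rewrite ltNge; apply/negP => /min_m; rewrite ltnn.
pose waiting k := [set s | forall j, (j <= k)%N -> ~ good s j].
have z0_feasible : feasible f z0 by case: z0_closest.
have mwaiting k : measurable (waiting k).
  exact: (measurable_waiting_time P W Gamma eps M_gt0 z0_feasible f_measurable
    f_lipschitz g_subgradient step_measurable k).
have tail k : (Q (waiting k) <= (binom_tail p k m)%:E)%E.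
  apply: (waiting_tail M_gt0 eps_gt0 z0_feasible f_measurable f_lipschitz
    g_subgradient sel_argmax step_measurable W_law W_indep) => //.
  by rewrite -distE.
split.
  apply: (expected_first_time_le mwaiting tail) => l.
  apply: le_trans (sum_binom_tail l m p_gt0 p_lt1) _.
  by rewrite ler_pdivrMr// EpN ltW.
move=> k kE.
(* [binom_tail_geometric] starts at [K = ceil (2 E) - 1] trials, where Markov's
   inequality gives one half. *)
have [K cK] : exists K : nat, Num.ceil (2 * E) = K.+1%:Z.
  have : 0 < Num.ceil (2 * E) by rewrite ceil_gt0 mulr_gt0.
  by case: (Num.ceil _) => [[|K]|K]// _; exists K.
have EK : 2 * E <= K.+1%:R.
  by have := ceil_ge (2 * E); rewrite cK.
have Kk : (K < k)%N.
  have : Num.ceil (2 * E) <= k%:Z by rewrite ceil_le_int.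
  by rewrite cK.
case: k kE Kk => [//|k] kE Kk; rewrite ltnS in Kk.
rewrite cK subzn; last exact: Kk.
rewrite subSS.
have -> : 1 / (1 + 1 / 2 * (p / (1 - p))) = (1 - p) / (1 - p / 2).
  by field; rewrite !gt_eqF//; lra.
have first_waiting : [set s | is_first (good s) k.+1] =
    waiting k `\` waiting k.+1.
  apply/seteqP; split=> s /=.
    by move=> [gk before]; split=> // /(_ k.+1 (leqnn _)); apply.
  move=> [sk]; rewrite /waiting/= => nsk; split=> //.
  apply: contrapT => ngk; apply: nsk => j; rewrite leq_eqVlt => /orP[/eqP ->//|].
  exact: sk.
have /le_trans -> // : (Q [set s | is_first (good s) k.+1] <= Q (waiting k))%E.
  rewrite first_waiting; apply: le_measure; rewrite ?inE//; exact: measurableD.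
apply: le_trans (tail k) _; rewrite lee_fin.
apply: binom_tail_geometric => //; apply: (le_trans (ltW mN)).
rewrite -EpN; move: (K.+1%:R : R) EK => r Er.
have := ler_wpM2r (ltW p_gt0) Er; lra.
Qed.
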